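(* Let $L\ge 2$ be an integer and let $h>0$, $\sigma>0$. Consider the KdV equation $u_t-6uu_x+u_{xxx}=0$ with initial data $u(x,0)=-\sum_{n=1}^{L}U_n\delta(x-x_n)$, where $U_n=h$ and $x_n=n\sigma$ for $n=1,\dots,L$. Set $$(\sigma h)_l^L=2+2\cos\left(\frac{l\pi}{L}\right),\quad l=1,2,\dots,L,\qquad (\sigma h)_0^L=+\infty .$$ Then the number $\sharp_L$ of discrete eigenvalues (equivalently, the number of solitons emerging from the initial data) is $$\sharp_L=L-j\quad\text{whenever}\quad (\sigma h)_{j+1}^L<\sigma h\le(\sigma h)_j^L,\qquad j=0,1,\dots,L-1,$$ where for $j=0$ the sign ''$\le$'' is replaced by ''$<$''.
   Context: Here $\delta$ is the Dirac delta function. The scattering matrix of the initial data $-\sum_{n=1}^L U_n\delta(x-x_n)$ with $x_1<\dots<x_L$ is $$S_L(k)=\left(I-\frac{\mathrm{i}U_L}{2k}e^{\mathrm{i}kx_L\sigma_3}Qe^{-\mathrm{i}kx_L\sigma_3}\right)\cdots\left(I-\frac{\mathrm{i}U_1}{2k}e^{\mathrm{i}kx_1\sigma_3}Qe^{-\mathrm{i}kx_1\sigma_3}\right),\quad Q=\begin{pmatrix}1&-1\\1&-1\end{pmatrix},\ \sigma_3=\begin{pmatrix}1&0\\0&-1\end{pmatrix}.$$ Discrete eigenvalues are the zeros of the entry $(S_L(k))_{11}$ on the positive imaginary axis $k\in\mathrm{i}\mathbb{R}_+$; each produces one soliton. $\sharp_L$ denotes their number. *)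

(* Defs.v *)
From mathcomp Require Import all_boot all_order all_algebra.
From mathcomp Require Import complex.
From mathcomp Require Import all_classical all_reals all_analysis.

Set Implicit Arguments.
Unset Strict Implicit.
Unset Printing Implicit Defensive.

Import Order.TTheory GRing.Theory Num.Theory.

Local Open Scope classical_set_scope.
Local Open Scope ring_scope.
Local Open Scope complex_scope.

Section ScatteringMatrix.
Variable R : realType.
Implicit Types (k z : R[i]) (U x : nat -> R).

Definition cexp z : R[i] :=
  (expR (complex.Re z))%:C * (cos (complex.Im z) +i* sin (complex.Im z)).

Definition matQ : 'M[R[i]]_2 := \matrix_(i, j) (if j == 0 then 1 else -1).

Definition sigma3 : 'M[R[i]]_2 :=
  diag_mx (\row_j (if j == 0 then 1 else -1)).

(* The matrix exponential e^{z sigma_3}; sigma_3 is diagonal, so the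
   exponential acts on the diagonal entries. *)
Definition exp_sigma3 z : 'M[R[i]]_2 :=
  diag_mx (\row_j cexp (z * sigma3 j j)).

(* The scope is explicit: without it 'i parses as Num.imaginary. *)
Definition delta_factor (u y : R) k : 'M[R[i]]_2 :=
  1%:M - ('i%C * u%:C / (2 * k)) *:
    (exp_sigma3 ('i%C * k * y%:C) *m matQ *m exp_sigma3 (- ('i%C * k * y%:C))).

(* Scattering matrix of the KdV initial data - \sum_(1 <= n <= L) U_n
   delta(x - x_n). U and x are indexed from 1 (their values at 0 are not used),
   and the factors are multiplied with n decreasing from left to right. *)
Fixpoint scattering U x (L : nat) k : 'M[R[i]]_2 :=
  if L is n.+1 then delta_factor (U n.+1) (x n.+1) k *m scattering U x n k
  else 1%:M.

Definition discrete_eigenvalues U x (L : nat) : set R[i] :=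
  [set k | [/\ complex.Re k = 0, 0 < complex.Im k
             & scattering U x L k ord0 ord0 = 0]].

Definition threshold (L l : nat) : \bar R :=
  if l is 0 then +oo%E else (2 + 2 * cos (l%:R * pi / L%:R))%:E.

End ScatteringMatrix.

(* Main.v *)
Require Import Defs.
From mathcomp Require Import all_boot all_order all_algebra.
From mathcomp Require Import complex.
From mathcomp Require Import all_classical all_reals all_analysis.
From mathcomp Require Import ring lra.

Set Implicit Arguments.
Unset Strict Implicit.
Unset Printing Implicit Defensive.

Import Order.TTheory GRing.Theory Num.Theory numFieldNormedType.Exports.

Local Open Scope classical_set_scope.
Local Open Scope ring_scope.

(** On the positive imaginary axis [k = i kappa] the transfer matrices are real.
    Write [s = kappa sigma], [E = e^s], [T = tanh (s / 2)] and
    [c = h / (2 kappa)].  The equally spaced factors are conjugates of one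
    another, so up to a power of [E] the first column of the scattering matrix
    is [(p_L, q_L)], the [L]-th iterate of a fixed unimodular 2 x 2 matrix [N]
    of trace [t = 2 cosh s - 2 c sinh s] started at [(1, 0)]
    ([scattering_transfer]).  A discrete eigenvalue is a zero of [p_L]: the
    bound state which starts as [e^(kappa x)] on the left has no growing part
    on the right.

    Outside the band [-2 < t < 2] there is no eigenvalue.  If [t >= 2] the
    values of the wave at the successive deltas do not decrease; if [t <= -2]
    they alternate in sign and do not decrease in modulus.  Both facts amount
    to the invariance of a cone ([transfer_above_band], [transfer_below_band]).
    Inside the band, put [t = 2 cos (2 x)] and define [y] by
    [tan x = T tan y].  Then [p_n = sin (2 n x + 2 y) / sin (2 y)]
    ([transfer_in_band]), so the eigenvalues are the points where the phase
    [L x + y] is a multiple of [pi / 2] ([transfer_eq0P]).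

    With [u = c T = a T / (2 s)] and [a = sigma h] one finds
    [tan x ^ 2 = (u - T ^ 2) / (1 - u)], and the band is [T ^ 2 < u < 1].
    Since [T] increases with [s] and [u] decreases with [s] (concavity of
    [tanh]), the phase is strictly decreasing in [s], so every multiple of
    [pi / 2] is reached at most once ([lt_phase]).  The phase vanishes at the
    end [t = 2] of the band.  At the other end it tends to
    [(L + 1) pi / 2] if [a > 4]; otherwise that end is [s = 0], where [u] tends
    to [a / 4], [T] to [0], and the phase to [L x0 + pi / 2] with
    [sin x0 ^ 2 = a / 4].  Since [4 sin ^ 2] of the angle
    [(L - j) pi / (2 L)] is the [j]-th threshold, the hypothesis on [a] says
    exactly that this limit lies above [(L - j) pi / 2] and is at most
    [(L - j + 1) pi / 2] ([phase_gt_edge], [phase_lt_edge]).  Hence the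
    multiples [m pi / 2] with [1 <= m <= L - j] are the ones attained. *)

(** * The hyperbolic tangent of half the spacing *)

Section Coupling.
Variable R : realType.
Implicit Types a s t : R.

Definition tanh_half s : R := (expR s - 1) / (expR s + 1).

Lemma tanh_half0 : tanh_half 0 = 0.
Proof. by rewrite /tanh_half expR0 subrr mul0r. Qed.

Lemma tanh_halfE s : tanh_half s = 1 - 2 / (expR s + 1).
Proof.
have := expR_gt0 s; rewrite /tanh_half => E0.
by field; lra.
Qed.

Lemma tanh_half_gt0 s : 0 < s -> 0 < tanh_half s.
Proof.
by move=> s0; rewrite divr_gt0 ?subr_gt0 ?expR_gt1 // addr_gt0 // expR_gt0.
Qed.

Lemma tanh_half_lt1 s : tanh_half s < 1.
Proof.
rewrite ltr_pdivrMr ?mul1r ?addr_gt0 ?expR_gt0 //; lra.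
Qed.

Lemma lt_tanh_half : {homo tanh_half : s t / s < t}.
Proof.
move=> s t st; have := expR_gt0 s; have := expR_gt0 t => t0 s0.
rewrite !tanh_halfE ltrD2l ltrN2 ltr_pM2l // ltf_pV2 ?posrE ?addr_gt0 //.
by rewrite ltrD2r ltr_expR.
Qed.

(** The inverse of the definition: it makes every quantity below a rational
    function of [T] and the coupling. *)
Lemma expR_tanh_half s :
  expR s = (1 + tanh_half s) / (1 - tanh_half s).
Proof.
have /ltr0_neq0 h1 : tanh_half s - 1 < 0 by rewrite subr_lt0 tanh_half_lt1.
move: (expR_gt0 s) h1; rewrite /tanh_half => E0 h1.
have e1 : expR s + 1 != 0 by rewrite gt_eqF // addr_gt0.
field; rewrite e1 /=.
by apply/eqP; lra.
Qed.

Lemma is_derive_tanh_half s :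
  is_derive s 1 tanh_half ((1 - tanh_half s ^+ 2) / 2).
Proof.
have e1 : expR s + 1 != 0 by rewrite gt_eqF // addr_gt0 // expR_gt0.
rewrite (_ : tanh_half = fun x => 1 - 2 * (expR x + 1)^-1); last first.
  by apply/funext => x; rewrite tanh_halfE.
have d1 : is_derive s 1 (fun x : R => expR x + 1) (expR s).
  by apply: is_derive_eq; rewrite addr0.
have d2 := @is_deriveV _ (fun x : R => expR x + 1) s _ _ e1 d1.
apply: is_derive_eq.
by rewrite /GRing.scale /=; field.
Qed.

Lemma continuous_tanh_half : continuous tanh_half.
Proof.
move=> s; apply: differentiable_continuous; apply/derivable1_diffP.
by have [] := is_derive_tanh_half s.
Qed.

Lemma tanh_half_mean_value s t : s < t -> exists2 u, s < u < t &
  tanh_half t - tanh_half s = (1 - tanh_half u ^+ 2) / 2 * (t - s).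
Proof.
move=> st.
have [|u] := MVT st (fun x _ => is_derive_tanh_half x).
  by apply: continuous_subspaceT; exact: continuous_tanh_half.
by rewrite in_itv /= => us e; exists u.
Qed.

(** This is [c T], where [c = a / (2 s)] is the strength of a delta relative
    to [kappa] and [T = tanh (s / 2)]; unlike [c] and [T] separately it has a
    finite nonzero limit, [a / 4], as [s] tends to [0]. *)
Definition coupling a s : R := a * tanh_half s / (2 * s).

(** The derivative of [tanh (s / 2)] is less than [1 / 2] away from [0]. *)
Lemma coupling_lt a s : 0 < a -> 0 < s -> coupling a s < a / 4.
Proof.
move=> a0 s0; have [u /andP[u0 us]] := tanh_half_mean_value s0.
rewrite tanh_half0 !subr0 /coupling => ->.
have T0 := tanh_half_gt0 u0.
rewrite ltr_pdivrMr ?mulr_gt0 //.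
have := mulr_gt0 (mulr_gt0 a0 s0) (exprn_gt0 2 T0).
by lra.
Qed.

Lemma coupling_gt0 a s : 0 < a -> 0 < s -> 0 < coupling a s.
Proof.
by move=> a0 s0; apply: divr_gt0; apply: mulr_gt0 => //; exact: tanh_half_gt0.
Qed.

Lemma tanh_half_lt_half s : 0 < s -> tanh_half s < s / 2.
Proof.
move=> s0; have := @coupling_lt 1 s ltr01 s0.
by rewrite /coupling ltr_pdivrMr ?mulr_gt0 //; lra.
Qed.

(** From [e^s >= 1 + s]; together with [coupling_lt] it gives the limit [a / 4]
    at [0] with an explicit rate. *)
Lemma coupling_ge a s : 0 < a -> 0 < s -> a / (2 * (2 + s)) <= coupling a s.
Proof.
move=> a0 s0; rewrite /coupling tanh_halfE.
have E0 : 0 < expR s + 1 by rewrite addr_gt0 // expR_gt0.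
have s2 : 0 < 2 + s by rewrite addr_gt0.
have : 2 / (expR s + 1) <= 2 / (2 + s).
  rewrite ler_pM2l // lef_pV2 ?posrE //.
  by have := expR_ge1Dx s; lra.
move=> h.
rewrite ler_pdivlMr ?mulr_gt0 // [X in X <= _](_ : _ = a * (1 - 2 / (2 + s))).
  by rewrite ler_pM2l // lerD2l lerN2.
by field; rewrite gt_eqF.
Qed.

(** Strict concavity of [tanh]: the slope of the chord over [[0, s]] is a value
    of the derivative [(1 - T ^ 2) / 2] to the left of [s], that over [[s, t]] a
    value to the right, and [T] increases. *)
Lemma lt_coupling a s t : 0 < a -> 0 < s -> s < t ->
  coupling a t < coupling a s.
Proof.
move=> a0 s0 st; have t0 := lt_trans s0 st.
have [u /andP[u0 us]] := tanh_half_mean_value s0.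
have [v /andP[sv vt]] := tanh_half_mean_value st.
rewrite tanh_half0 !subr0 => et es.
have uv : tanh_half u < tanh_half v by apply: lt_tanh_half; lra.
have := tanh_half_gt0 u0 => u0'.
have sq : tanh_half u ^+ 2 < tanh_half v ^+ 2.
  by rewrite ltr_pXn2r // nnegrE ltW // (lt_trans u0').
rewrite /coupling ltr_pdivrMr ?mulr_gt0 // mulrAC ltr_pdivlMr ?mulr_gt0 //.
have -> : tanh_half t = (1 - tanh_half v ^+ 2) / 2 * (t - s) + tanh_half s.
  by rewrite -et; ring.
rewrite es -subr_gt0.
set X := tanh_half u ^+ 2 in sq *; set Y := tanh_half v ^+ 2 in sq *.
rewrite (_ : _ - _ = a * s * (t - s) * (Y - X)); last by field.
by rewrite !mulr_gt0 ?subr_gt0.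
Qed.

Lemma continuous_coupling a s : 0 < s -> {for s, continuous (coupling a)}.
Proof.
move=> s0; apply: cvgM.
  by apply: cvgMr; exact: continuous_tanh_half.
apply: cvgV; first by rewrite gt_eqF // mulr_gt0.
by apply: cvgMr; exact: cvg_id.
Qed.

End Coupling.

(** * The scattering matrix on the imaginary axis *)

Section Transfer.
Variable R : realType.
Local Open Scope complex_scope.
Implicit Types (c E h kappa sigma y : R) (n : nat).

Lemma cexp_real y : cexp y%:C = (expR y)%:C.
Proof. by rewrite /cexp /= cos0 sin0 mulr1. Qed.

(** [1 - c Q] conjugated by [diag (1 / X, X)]; all entries are real. *)
Lemma delta_factor_imag h y kappa (c := h / (2 * kappa))
    (X := expR (kappa * y)) (D := delta_factor h y (0 +i* kappa)) :
  kappa != 0 ->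
  [/\ D 0 0 = (1 - c)%:C, D 0 1 = (c / X ^+ 2)%:C,
      D 1 0 = (- c * X ^+ 2)%:C & D 1 1 = (1 + c)%:C].
Proof.
move=> k0.
have kC : kappa%:C != 0 by rewrite fmorph_eq0.
have iC : 'i%C != 0 :> R[i] by rewrite eq_complex /= oner_eq0 andbF.
have ck : 'i%C * h%:C / (2 * (0 +i* kappa)) = c%:C.
  have -> : 0 +i* kappa = 'i%C * kappa%:C.
    by apply/eqP; rewrite eq_complex /=; apply/andP; split; apply/eqP; ring.
  by rewrite rmorphM fmorphV rmorphM rmorph_nat /=; field; rewrite kC iC.
have ik : 'i%C * (0 +i* kappa) * y%:C = (- (kappa * y))%:C.
  by apply/eqP; rewrite eq_complex /=; apply/andP; split; apply/eqP; ring.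
have X0 : X != 0 by rewrite gt_eqF // expR_gt0.
pose sg (j : 'I_2) : R := if j == 0 then 1 else -1.
have QE i j : matQ R i j = (sg j)%:C.
  by rewrite mxE /sg; case: ifP; rewrite ?rmorph1 ?rmorphN1.
have sE j : sigma3 R j j = (sg j)%:C.
  by rewrite !mxE eqxx /= /sg; case: ifP; rewrite ?rmorph1 ?rmorphN1.
have DE i j : D i j = ((i == j)%:R - c *
    (expR (- (kappa * y) * sg i) * sg j * expR (kappa * y * sg j)))%:C.
  rewrite /D /delta_factor /exp_sigma3 ck ik mul_diag_mx mul_mx_diag.
  move: (sigma3 R) (matQ R) sE QE => s3 Q sE QE.
  rewrite -!rmorphN opprK !mxE !sE QE -!rmorphM !cexp_real.
  by rewrite rmorphB !rmorphM rmorph_nat.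
by split; rewrite DE /sg /= ?mulr1 ?mulrN1 ?opprK ?expRN -/X;
  congr (_%:C); field.
Qed.

(** Iterates of [N = (1 - c Q) diag (E, 1 / E)] on [(1, 0)]: propagate over one
    period, then cross a delta.  With [x] measured from that delta, the wave on
    its right is [p e^(kappa x) - q e^(-kappa x)], so that [p - q] is its value
    at the delta and [E p - q / E] its value at the next one. *)
Fixpoint transfer c E n : R * R :=
  if n is m.+1 then
    let: (p, q) := transfer c E m in
    ((1 - c) * E * p + c / E * q, - c * E * p + (1 + c) / E * q)
  else (1, 0).

(** The factor at [x_m = m sigma] is [D ^ m (1 - c Q) D ^ - m] with
    [D = diag (1 / E, E)]; the intermediate powers of [D] telescope to one
    factor [D ^ - 1] per period, leaving [D ^ n] in front of the iterate. *)
Lemma scattering_transfer h sigma kappa n (c := h / (2 * kappa))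
    (E := expR (kappa * sigma))
    (S := scattering (fun=> h) (fun i => i%:R * sigma) n (0 +i* kappa)) :
  kappa != 0 ->
  S 0 0 = ((transfer c E n).1 / E ^+ n)%:C /\
  S 1 0 = ((transfer c E n).2 * E ^+ n)%:C.
Proof.
move=> k0; rewrite {}/S.
have E0 : E != 0 by rewrite gt_eqF // expR_gt0.
elim: n => [|n]; first by rewrite /= !mxE /= mul0r divr1.
case tE : (transfer c E n) => [p q] /= [IH0 IH1].
have [] := delta_factor_imag h (n.+1%:R * sigma) k0.
rewrite mulrCA expRM_natl -/E.
rewrite -/c => D00 D01 D10 D11.
rewrite !mxE !big_ord_recl !big_ord0 /= tE /=.
have -> : lift ord0 ord0 = 1 :> 'I_2 by apply/val_inj.
rewrite D00 D01 D10 D11 IH0 IH1 !addr0 -!rmorphM -!rmorphD /=.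
by split; congr (_%:C); rewrite !exprS; field; rewrite E0 expf_neq0.
Qed.

End Transfer.

(** * Zeros of the transfer recursion *)

Section TransferZeros.
Variable R : realType.
Implicit Types (c E T w x y z : R) (n : nat).

(** The hypothesis is [c <= T], that is, trace at least [2].  The inequality
    [E p + q >= 0] says that the wave does not decrease from one delta to the
    next, since [(E p - q / E) - (p - q) = (E - 1) (p + q / E)].  Together with
    [p > 0 >= q] it is preserved. *)
Lemma transfer_above_band c E n : 1 < E -> 0 < c -> c * (E + 1) <= E - 1 ->
  (transfer c E n).1 != 0.
Proof.
move=> E1 c0 hc.
suff [p0 _ _] : [/\ 0 < (transfer c E n).1, (transfer c E n).2 <= 0
    & 0 <= E * (transfer c E n).1 + (transfer c E n).2] by rewrite gt_eqF.
elim: n => [|n] /=; first by split=> //=; lra.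
case: (transfer c E n) => [p q] /= [p0 q0 pq].
have E0 : 0 < E by lra.
have q'E : - (E * p) / E <= q / E by rewrite ler_pM2r ?invr_gt0 //; lra.
have eE : - (E * p) / E = - p by field; lra.
have cq : - (c * p) <= c * (q / E).
  by rewrite -mulrN ler_pM2l // -eE.
have q1 : q / E <= 0 by rewrite pmulr_lle0 ?invr_gt0.
have Ep : 0 <= (E - 1) * p - c * (E + 1) * p.
  by rewrite -mulrBl mulr_ge0 ?subr_ge0 // ltW.
have cqE : c / E * q = c * (q / E) by field; lra.
have dqE : (1 + c) / E * q = (1 + c) * (q / E) by field; lra.
have qE : E * (q / E) = q by field; lra.
rewrite cqE dqE; split.
- have cp : 0 < c * p by rewrite mulr_gt0.
  nra.
- nra.
- have : 0 <= (E + 1) * ((E - 1) * p - c * (E + 1) * p).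
    by apply: mulr_ge0 => //; lra.
  nra.
Qed.

(** The hypothesis is [c T >= 1], that is, trace at most [-2].  After the sign
    change [(-1) ^ n] the cone [0 <= Q <= E P] is preserved and [P] stays
    positive. *)
Lemma transfer_below_band c E n : 1 < E -> E + 1 <= c * (E - 1) ->
  (transfer c E n).1 != 0.
Proof.
move=> E1 hc.
pose P m := (-1) ^+ m * (transfer c E m).1.
pose Q m := (-1) ^+ m * (transfer c E m).2.
suff [p0 _ _] : [/\ 0 < P n, 0 <= Q n & Q n <= E * P n].
  by apply: contraTneq p0; rewrite /P => ->; rewrite mulr0 ltxx.
have E0 : 0 < E by lra.
have c1 : 1 < c by nra.
elim: n => [|n]; first by rewrite /P /Q /= !expr0; split; lra.
have eP : P n.+1 = (c - 1) * E * P n - c * (Q n / E).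
  rewrite /P /Q /=; case: (transfer c E n) => p q /=.
  by rewrite exprS; field; lra.
have eQ : Q n.+1 = c * E * P n - (1 + c) * (Q n / E).
  rewrite /P /Q /=; case: (transfer c E n) => p q /=.
  by rewrite exprS; field; lra.
move=> [p0 q0 pq]; rewrite eP eQ.
have q1 : Q n / E <= P n by rewrite ler_pdivrMr // mulrC.
have q2 : 0 <= Q n / E by rewrite divr_ge0 // ltW.
move: (P n) (Q n / E) p0 q1 q2 {eP eQ pq} => p r p0 rp r0.
have k1 : 0 <= (c * (E - 1) - (E + 1)) * p by rewrite mulr_ge0 ?subr_ge0 // ltW.
have k2 : 0 <= (c * (E - 1) - (E + 1)) * p * (E - 1).
  by rewrite mulr_ge0 // subr_ge0 ltW.
have k3 : 0 <= (p - r) * c by rewrite mulr_ge0 ?subr_ge0 //; lra.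
have k4 : 0 <= (p - r) * (c * (E - 1) - 1).
  by rewrite mulr_ge0 ?subr_ge0 //; lra.
have k5 : 0 < (E - 1) * p by rewrite mulr_gt0 // subr_gt0.
by split; nra.
Qed.

(** The powers of a unimodular matrix of trace [2 cos x] are combinations of
    [cos (n x)] and [sin (n x)].  The relations between [x] and [y] are what the
    addition formulas require of one step of the recursion; they imply
    [2 cos x = (1 - c) E + (1 + c) / E], the trace. *)
Lemma transfer_in_band c E x y n : E != 0 -> sin y != 0 ->
    sin x = c * sin y -> cos x = c * cos y + (1 + c) / E ->
    cos x = (1 - c) * E - c * cos y ->
  transfer c E n =
    (sin (n%:R * x + y) / sin y, - E * sin (n%:R * x) / sin y).
Proof.
move=> E0 y0 sx cx1 cx2; elim: n => [|n IH].
  by rewrite /= !mul0r add0r divff // sin0 mulr0 mul0r.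
rewrite /= IH; congr pair.
- rewrite (_ : n.+1%:R * x + y = (n%:R * x + y) + x); last first.
    by rewrite -natr1; ring.
  have := addrK y (n%:R * x); move: (n%:R * x + y) => z <-.
  by rewrite sinB sinD cx2 sx; field; rewrite E0 y0.
- rewrite (_ : n.+1%:R * x = n%:R * x + x); last by rewrite -natr1; ring.
  move: (n%:R * x) => z.
  by rewrite !sinD cx1 sx; field; rewrite E0 y0.
Qed.

Lemma sin_mul_nat_pi n : sin (n%:R * pi) = 0 :> R.
Proof.
by rewrite mulr_natl -[_ *+ n]add0r (alternatingn (@sinDpi R)) sin0 mulr0.
Qed.

Lemma sin_eq0_gt0 z : 0 < z -> sin z = 0 -> exists n : nat, z = n.+1%:R * pi.
Proof.
move=> z0 sz; have p0 := pi_gt0 R.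
have := truncn_itv (ltW (divr_gt0 z0 p0)).
set m := Num.trunc _; rewrite ler_pdivlMr // ltr_pdivrMr // => /andP[le_m lt_m].
have zE : z = m%:R * pi.
  apply/eqP; rewrite eq_le le_m andbT leNgt; apply/negP => m_lt.
  have : 0 < sin (z - m%:R * pi).
    by apply: sin_gt0_pi; move: lt_m; rewrite -natr1; lra.
  by rewrite sinB sz mul0r sin_mul_nat_pi mulr0 subr0 ltxx.
case: m zE {le_m lt_m} => [|m] zE; last by exists m.
by move: z0; rewrite zE mul0r ltxx.
Qed.

Lemma cos_atan_neq0 w : cos (atan w) != 0.
Proof. by rewrite gt_eqF // cos_gt0_pihalf ?atan_gtNpi2 ?atan_ltpi2. Qed.

Lemma sin_double_atan w : sin (2 * atan w) = 2 * w / (1 + w ^+ 2).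
Proof.
have c0 := cos_atan_neq0 w.
have := cos2_tan2 c0; rewrite atanK => <-.
have -> : 2 * w = 2 * tan (atan w) by rewrite atanK.
by rewrite mulr_natl sin_mulr2n -mulr_natl /tan; field.
Qed.

Lemma cos_double_atan w : cos (2 * atan w) = (1 - w ^+ 2) / (1 + w ^+ 2).
Proof.
have c0 := cos_atan_neq0 w.
have := cos2_tan2 c0; rewrite atanK => e.
have -> : 1 - w ^+ 2 = 2 - cos (atan w) ^- 2 by rewrite e; ring.
by rewrite -e mulr_natl cos_mulr2n -mulr_natl; field.
Qed.

(** Instance of [transfer_in_band] at the angles [2 x] and [2 y] with
    [x = atan w], [y = atan (w / T)].  Its relations become rational identities
    in [c] and [T] because
    [1 + w ^ 2 = (1 - T ^ 2) / (1 - c T)] and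
    [1 + (w / T) ^ 2 = c (1 - T ^ 2) / (T (1 - c T))]. *)
Lemma transfer_eq0_atan c T w n (E := (1 + T) / (1 - T)) : 0 < T -> T < 1 ->
    0 < w -> w ^+ 2 = (c * T - T ^+ 2) / (1 - c * T) -> c * T < 1 -> T < c ->
  ((transfer c E n).1 == 0) = (sin (2 * (n%:R * atan w + atan (w / T))) == 0).
Proof.
move=> T0 T1 w0 wE cT Tc.
have c0 : 0 < c by lra.
have e1 : 1 + w ^+ 2 = (1 - T ^+ 2) / (1 - c * T) by rewrite wE; field; lra.
have e2 : 1 + (w / T) ^+ 2 = c * (1 - T ^+ 2) / (T * (1 - c * T)).
  by rewrite expr_div_n wE; field; lra.
have T2 : 1 - T ^+ 2 != 0.
  by rewrite gt_eqF // subr_gt0 expr_lt1 // ltW.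
have T3 : 1 - T != 0 by lra.
have T4 : 1 + T != 0 by lra.
have T5 : T != 0 by lra.
have T6 : 1 - c * T != 0 by lra.
have c1 : c != 0 by lra.
have sx : sin (2 * atan w) = 2 * w * (1 - c * T) / (1 - T ^+ 2).
  by rewrite sin_double_atan e1; field; rewrite T2 T6.
have sy : sin (2 * atan (w / T)) = 2 * w * (1 - c * T) / (c * (1 - T ^+ 2)).
  by rewrite sin_double_atan e2; field; rewrite T2 T6 T5 c1.
have cx : cos (2 * atan w) = (1 - 2 * (c * T) + T ^+ 2) / (1 - T ^+ 2).
  by rewrite cos_double_atan e1 wE; field; rewrite T2 T6.
have cy : cos (2 * atan (w / T)) =
    (2 * T - c * T ^+ 2 - c) / (c * (1 - T ^+ 2)).
  by rewrite cos_double_atan e2 expr_div_n wE; field; rewrite T2 T6 T5 c1.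
have sy0 : sin (2 * atan (w / T)) != 0.
  rewrite sy !mulf_neq0 ?invr_eq0 ?mulf_neq0 //; lra.
rewrite (@transfer_in_band c E (2 * atan w) (2 * atan (w / T))) //=.
- rewrite mulf_eq0 invr_eq0 (negPf sy0) orbF; congr (sin _ == 0); ring.
- by rewrite mulf_neq0 // invr_eq0.
- by rewrite sx sy; field; rewrite T2 c1.
- rewrite cx cy /E (_ : 1 - T ^+ 2 = (1 - T) * (1 + T)); last by ring.
  by field; rewrite c1 T3 T4.
- rewrite cx cy /E (_ : 1 - T ^+ 2 = (1 - T) * (1 + T)); last by ring.
  by field; rewrite c1 T3 T4.
Qed.

End TransferZeros.

(** * The phase and its monotonicity *)

Section Phase.
Variable R : realType.
Implicit Types (a s t x K : R) (L m : nat).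

(** The quantity [tan x] where [2 cos (2 x)] is the trace of one period.  The
    square root is [0] on the side [coupling a s <= tanh_half s ^+ 2] of the
    band, which extends the phase by [0] there. *)
Definition half_angle_tan a s : R :=
  Num.sqrt ((coupling a s - tanh_half s ^+ 2) / (1 - coupling a s)).

Definition phase L a s : R :=
  L%:R * atan (half_angle_tan a s) + atan (half_angle_tan a s / tanh_half s).

Lemma atan_gt0 x : 0 < x -> 0 < atan x.
Proof. by move=> x0; rewrite -[ltLHS]atan0 lt_atan. Qed.

Lemma sqr_half_angle_tan a s : tanh_half s ^+ 2 <= coupling a s ->
    coupling a s < 1 ->
  half_angle_tan a s ^+ 2 =
  (coupling a s - tanh_half s ^+ 2) / (1 - coupling a s).
Proof. by move=> h1 h2; rewrite sqr_sqrtr // divr_ge0 // subr_ge0 // ltW. Qed.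

Lemma half_angle_tan_gt0 a s : coupling a s < 1 ->
  (0 < half_angle_tan a s) = (tanh_half s ^+ 2 < coupling a s).
Proof. by move=> u1; rewrite sqrtr_gt0 pmulr_lgt0 ?invr_gt0 subr_gt0. Qed.

(** The extension by [0] past the upper end of the band is continuous, so the
    intermediate value theorem applies without a limit at that end. *)
Lemma phase_eq0 L a s : coupling a s < 1 -> coupling a s <= tanh_half s ^+ 2 ->
  phase L a s = 0.
Proof.
move=> u1 uT; rewrite /phase (_ : half_angle_tan a s = 0).
  by rewrite mul0r atan0 mulr0 addr0.
by apply/ler0_sqrtr; rewrite pmulr_lle0 ?invr_gt0 ?subr_gt0 // subr_le0.
Qed.

Lemma phase_gt0 L a s : 0 < s -> tanh_half s ^+ 2 < coupling a s ->
  coupling a s < 1 -> 0 < phase L a s.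
Proof.
move=> s0 Tu u1; have w0 : 0 < half_angle_tan a s by rewrite half_angle_tan_gt0.
apply: ltr_wpDl; first by rewrite mulr_ge0 // ltW // atan_gt0.
by rewrite atan_gt0 // divr_gt0 // tanh_half_gt0.
Qed.

(** The eigenvalue condition: [p_L = 0] forces the band, and there it reads
    [sin (2 (L x + y)) = 0] with [L x + y > 0]. *)
Lemma transfer_eq0P L a s : 0 < a -> 0 < s ->
  (transfer (a / (2 * s)) (expR s) L).1 = 0 <->
  [/\ tanh_half s ^+ 2 < coupling a s, coupling a s < 1
    & exists m : nat, phase L a s = m.+1%:R * (pi / 2)].
Proof.
move=> a0 s0.
have T0 := tanh_half_gt0 s0; have T1 := tanh_half_lt1 s.
have E1 : 1 < expR s by rewrite expR_gt1.
have c0 : 0 < a / (2 * s) by rewrite divr_gt0 // mulr_gt0.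
have cT : a / (2 * s) * tanh_half s = coupling a s by rewrite /coupling mulrAC.
have ET : (expR s + 1) * tanh_half s = expR s - 1.
  by rewrite /tanh_half; field; lra.
have [Tc|cleT] := ltP (tanh_half s ^+ 2) (coupling a s); last first.
  split=> [/eqP|[]//]; apply: contraTP => _.
  apply: transfer_above_band => //.
  rewrite -ET mulrC ler_pM2l; last by lra.
  by move: cleT; rewrite -cT expr2 ler_pM2r.
have [u1|u1] := ltP (coupling a s) 1; last first.
  split=> [/eqP|[]//]; apply: contraTP => _.
  apply: transfer_below_band => //.
  rewrite -ET mulrCA -[leLHS]mulr1 ler_pM2l; last by lra.
  by rewrite cT.
have w0 : 0 < half_angle_tan a s by rewrite half_angle_tan_gt0.
have ph := phase_gt0 L s0 Tc u1.
have P := @transfer_eq0_atan _ (a / (2 * s)) _ _ L T0 T1 w0.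
rewrite -expR_tanh_half cT sqr_half_angle_tan ?(ltW Tc) // in P.
have {}P := P erefl u1.
have Tc' : tanh_half s < a / (2 * s) by rewrite -(ltr_pM2r T0) cT -expr2.
have {}P := P Tc'; rewrite -/(phase L a s) in P.
split=> [/eqP|[_ _ [m pm]]].
  rewrite P => /eqP /sin_eq0_gt0 -/(_ _)[|m pm]; first by rewrite mulr_gt0.
  by split=> //; exists m; lra.
apply/eqP; rewrite P pm (_ : 2 * _ = m.+1%:R * pi); last by field.
by rewrite sin_mul_nat_pi.
Qed.

(** In [tan x ^ 2 = (u - T ^ 2) / (1 - u)] the numerator decreases and the
    denominator increases with [s], and [tan y = tan x / T] with [T] increasing.
    Only the larger point must be known to satisfy [T ^ 2 < u], and only the
    smaller one [u < 1], as both conditions propagate. *)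
Lemma lt_phase L a s t : 0 < a -> 0 < s -> s < t -> coupling a s < 1 ->
  tanh_half t ^+ 2 < coupling a t -> phase L a t < phase L a s.
Proof.
move=> a0 s0 st us Tt; have t0 := lt_trans s0 st.
have uts := lt_coupling a0 s0 st.
have ut := lt_trans uts us.
have Ts0 := tanh_half_gt0 s0; have Tt0 := tanh_half_gt0 t0.
have Tst := lt_tanh_half st.
have T2st : tanh_half s ^+ 2 < tanh_half t ^+ 2.
  by rewrite ltr_pXn2r // nnegrE ltW.
have wt0 : 0 < half_angle_tan a t by rewrite half_angle_tan_gt0.
have ws0 : 0 < half_angle_tan a s by rewrite half_angle_tan_gt0 //; lra.
have wts : half_angle_tan a t < half_angle_tan a s.
  rewrite -(@ltr_pXn2r _ 2) ?nnegrE ?ltW // !sqr_half_angle_tan //; try lra.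
  rewrite ltr_pdivrMr ?subr_gt0 // mulrAC ltr_pdivlMr ?subr_gt0 //.
  apply: ltr_pM; rewrite ?subr_ge0 ?ltW //; lra.
apply: ler_ltD.
  by rewrite ler_wpM2l // ltW // lt_atan.
apply: lt_atan; rewrite ltr_pM // ?invr_ge0 ?ltW // ltf_pV2 //.
Qed.

Lemma phase_lt L a s : phase L a s < (L%:R + 1) * (pi / 2).
Proof.
rewrite mulrDl mul1r; apply: ler_ltD; last exact: atan_ltpi2.
by rewrite ler_wpM2l // ltW // atan_ltpi2.
Qed.

(** Since [u < a / 4 <= sin x ^ 2] inside the band, the first angle is at most
    [x], and the second one is always less than [pi / 2]. *)
Lemma phase_lt_edge L a s x : 0 < a -> 0 < s -> coupling a s < 1 ->
    tanh_half s ^+ 2 < coupling a s ->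
    0 <= x < pi / 2 -> a / 4 <= sin x ^+ 2 ->
  phase L a s < L%:R * x + pi / 2.
Proof.
move=> a0 s0 u1 Tu /andP[x0 xpi] ax.
have pi0 := pi_gt0 R.
have cx : 0 < cos x by apply: cos_gt0_pihalf; lra.
apply: ler_ltD; last exact: atan_ltpi2.
rewrite ler_wpM2l // -[leRHS]tanK; last by rewrite in_itv /=; lra.
apply: le_atan.
have tx0 : 0 <= tan x by rewrite divr_ge0 ?(ltW cx) // sin_ge0_pi //; lra.
rewrite -(@ler_pXn2r _ 2) ?nnegrE ?sqrtr_ge0 // sqr_half_angle_tan ?(ltW Tu) //.
have ux := lt_le_trans (coupling_lt a0 s0) ax.
have T2 := exprn_gt0 2 (tanh_half_gt0 s0).
rewrite /tan [leRHS]expr_div_n ler_pdivlMr ?exprn_gt0 //.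
rewrite mulrAC ler_pdivrMr ?subr_gt0 //.
rewrite cos2sin2; have := sin2cos2 x.
have := exprn_gt0 2 cx.
set S := sin x ^+ 2 in ux ax *; set C := cos x ^+ 2 => C0 e.
have : 0 < tanh_half s ^+ 2 * C by rewrite mulr_gt0.
rewrite (_ : C = 1 - S); [lra|lra].
Qed.

Lemma continuous_phase L a s : 0 < s -> coupling a s < 1 ->
  {for s, continuous (phase L a)}.
Proof.
move=> s0 u1.
have cT := @continuous_tanh_half R s.
have cu := @continuous_coupling R a s s0.
have cw : {for s, continuous (half_angle_tan a)}.
  apply: continuous_comp; last exact: sqrt_continuous.
  apply: cvgM.
    by apply: cvgB => //; apply: cvgM.
  apply: cvgV; first by rewrite gt_eqF // subr_gt0.
  by apply: cvgB => //; exact: cvg_cst.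
apply: cvgD.
  apply: cvgM; first exact: cvg_cst.
  apply: continuous_comp; first exact: cw.
  exact: continuous_atan.
apply: continuous_comp; last exact: continuous_atan.
by apply: cvgM => //; apply: cvgV => //; rewrite gt_eqF // tanh_half_gt0.
Qed.

(** Approach to the lower end of the band: there [tan ^ 2] of the first angle
    exceeds any [x ^ 2] below its limit, which is [(a / 4) / (1 - a / 4)] if
    [a < 4] and infinite otherwise, while [tan ^ 2] of the second one exceeds
    any [K ^ 2].  For [a <= 4] the end is [s = 0]; for [a > 4] it is the point
    where the coupling equals [1]. *)
Lemma exists_near_band_edge a x K : 0 < a ->
    x ^+ 2 * (1 - a / 4) < a / 4 ->
  exists s, [/\ 0 < s, coupling a s < 1,
    x ^+ 2 * (1 - coupling a s) < coupling a s - tanh_half s ^+ 2 &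
    K ^+ 2 * (tanh_half s ^+ 2 * (1 - coupling a s)) <
      coupling a s - tanh_half s ^+ 2].
Proof.
move=> a0 xa.
have x2 : 0 <= x ^+ 2 by exact: sqr_ge0.
have K2 : 0 <= K ^+ 2 by exact: sqr_ge0.
move: (x ^+ 2) (K ^+ 2) x2 K2 xa => {K}x' k x0 k0 xa {x}.
have [a4|a4] := leP a 4.
  (* For [s < 1] both requirements lose at most [s * M] from their margins at
     [s = 0], the smaller of which is [d]. *)
  pose d := Num.min (a / 4 - x' * (1 - a / 4)) (a / 4).
  pose M := a * (1 + x') / 8 + (1 + k) / 4.
  have d0 : 0 < d by rewrite lt_min subr_gt0 xa divr_gt0.
  have M0 : 0 < M.
    by rewrite addr_gt0 // divr_gt0 // ?mulr_gt0 // ltr_wpDr.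
  have [s [s0 s1 sM]] : exists s, [/\ 0 < s, s < 1 & s * M < d].
    have dM := addr_gt0 d0 M0.
    exists (d / (d + M)); split; first by rewrite divr_gt0.
      by rewrite ltr_pdivrMr // mul1r ltrDl.
    by rewrite mulrAC ltr_pdivrMr // ltr_pM2l // ltrDr.
  have u4 := coupling_lt a0 s0.
  have uge : a / 4 - a * s / 8 <= coupling a s.
    apply: le_trans (coupling_ge a0 s0).
    rewrite ler_pdivlMr ?mulr_gt0 ?addr_gt0 //.
    rewrite [leLHS](_ : _ = a - a * s ^+ 2 / 4); last by field.
    by rewrite gerBl divr_ge0 // mulr_ge0 ?sqr_ge0 // ltW.
  have T0 := tanh_half_gt0 s0; have Ts := tanh_half_lt_half s0.
  have T2 : tanh_half s ^+ 2 <= s / 4.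
    have : tanh_half s ^+ 2 <= (s / 2) ^+ 2.
      by rewrite ler_pXn2r ?nnegrE ?ltW // divr_gt0.
    have : s ^+ 2 <= s by rewrite expr2 ger_pMr // ltW.
    rewrite expr_div_n; lra.
  have T2' : 0 <= tanh_half s ^+ 2 := sqr_ge0 _.
  have [d1 d2] : d <= a / 4 - x' * (1 - a / 4) /\ d <= a / 4.
    by split; rewrite /d ge_min lexx ?orbT.
  have as0 : 0 < a * s by rewrite mulr_gt0.
  have h1 : x' * (a / 4 - a * s / 8) <= x' * coupling a s by rewrite ler_wpM2l.
  have h2 : k * tanh_half s ^+ 2 <= k * (s / 4) by rewrite ler_wpM2l.
  have h3 : 0 <= (k * tanh_half s ^+ 2) * coupling a s.
    apply: mulr_ge0; first exact: mulr_ge0.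
    exact: ltW (coupling_gt0 a0 s0).
  have h4 : 0 <= a * s * x' by rewrite mulr_ge0 // ltW.
  have h5 : 0 <= s * k by rewrite mulr_ge0 // ltW.
  exists s; split=> //.
  - lra.
  - rewrite /M in sM; lra.
  - rewrite /M in sM; lra.
have [v v0 uv] : exists2 v, 0 < v & coupling a v = 1.
  (* The lower bound [a / (2 (2 + s))] on the coupling equals [1] here. *)
  pose s := (a - 4) / 2.
  have s0 : 0 < s by rewrite divr_gt0 // subr_gt0.
  have sa : s <= a by rewrite /s; lra.
  have us : 1 <= coupling a s.
    apply: le_trans (coupling_ge a0 s0).
    by rewrite ler_pdivlMr /s; lra.
  have ua : coupling a a <= 1.
    rewrite /coupling ler_pdivrMr ?mulr_gt0 // mul1r mulrC ler_pM2r //.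
    by have := tanh_half_lt1 a; lra.
  have [||v] := @IVT R (coupling a) s a 1 sa.
  - apply: continuous_in_subspaceT => z; rewrite inE /= in_itv /= => /andP[sz _].
    by apply: continuous_coupling; lra.
  - by rewrite ge_min ua orbT /= le_max us.
  - rewrite in_itv /= => /andP[sv _] uv; exists v => //; lra.
(* Positivity of [g] implies both requirements, as [T ^ 2 < 1]; at the point
   [v] where the coupling is [1] it reduces to [1 - T ^ 2 > 0]. *)
pose g s := coupling a s - tanh_half s ^+ 2 - (x' + k) * (1 - coupling a s).
have T1 := tanh_half_lt1 v; have T0 := tanh_half_gt0 v0.
have gv : 0 < g v.
  rewrite /g uv subrr mulr0 subr0 subr_gt0 expr_lt1 // ltW //.
have cg : {for v, continuous g}.
  have cT := @continuous_tanh_half R v.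
  have cu := @continuous_coupling R a v v0.
  apply: cvgB; first by apply: cvgB => //; apply: cvgM.
  apply: cvgM; first exact: cvg_cst.
  by apply: cvgB => //; exact: cvg_cst.
have [s [gs vs]] : exists s, 0 < g s /\ v < s.
  apply: (@filter_ex _ v^'+); near=> s; split; near: s.
    by apply: (@cvgr_gt _ _ _ _ g (g v)) gv; apply: cvg_at_right_filter.
  exact: nbhs_right_gt.
have s0 := lt_trans v0 vs.
have u1 : coupling a s < 1 by rewrite -uv; apply: lt_coupling.
have u1' : 0 < 1 - coupling a s by rewrite subr_gt0.
have T2 : tanh_half s ^+ 2 < 1.
  by rewrite expr_lt1 ?tanh_half_lt1 // ltW // tanh_half_gt0.
have xu : 0 <= x' * (1 - coupling a s) by rewrite mulr_ge0 // ltW.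
have ku : 0 <= k * (1 - coupling a s) by rewrite mulr_ge0 // ltW.
have kuT : k * (tanh_half s ^+ 2 * (1 - coupling a s)) <=
    k * (1 - coupling a s).
  by rewrite ler_wpM2l // ler_piMl // ltW.
exists s; split=> //; rewrite /g in gs; lra.
Unshelve. all: by end_near.
Qed.

(** The room left by the strict hypothesis is used twice: the first angle is
    pushed beyond [x] to some [atan y], and the resulting gain
    [L (atan y - x)] pays for the deficit of the second angle from [pi / 2]. *)
Lemma phase_gt_edge L a x : (0 < L)%N -> 0 < a -> 0 <= x < pi / 2 ->
    sin x ^+ 2 < a / 4 ->
  exists s, [/\ 0 < s, coupling a s < 1 & L%:R * x + pi / 2 < phase L a s].
Proof.
move=> L0 a0 /andP[x0 xpi] xa.
have pi0 := pi_gt0 R.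
have cx : 0 < cos x by apply: cos_gt0_pihalf; lra.
have tx0 : 0 <= tan x by rewrite divr_ge0 ?(ltW cx) // sin_ge0_pi //; lra.
have txa : tan x ^+ 2 * (1 - a / 4) < a / 4.
  rewrite /tan expr_div_n mulrAC ltr_pdivrMr ?exprn_gt0 //.
  have := sin2cos2 x; set S := sin x ^+ 2 in xa *; set C := cos x ^+ 2 => e.
  rewrite (_ : C = 1 - S); lra.
have [y xy ya] : exists2 y, tan x < y & y ^+ 2 * (1 - a / 4) < a / 4.
  have [a4|a4] := leP 4 a.
    exists (tan x + 1); first by rewrite ltrDl.
    have : (tan x + 1) ^+ 2 * (1 - a / 4) <= 0.
      by rewrite mulr_ge0_le0 ?sqr_ge0 //; lra.
    by move=> h; apply: le_lt_trans h _; rewrite divr_gt0.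
  pose B := a / 4 / (1 - a / 4).
  have a1 : 0 < 1 - a / 4 by lra.
  have xB : tan x ^+ 2 < B by rewrite ltr_pdivlMr.
  have t2 : 0 <= tan x ^+ 2 := sqr_ge0 _.
  exists (Num.sqrt ((tan x ^+ 2 + B) / 2)).
    rewrite -[ltLHS](ger0_norm tx0) -sqrtr_sqr ltr_sqrt; lra.
  rewrite sqr_sqrtr -?ltr_pdivlMr // -/B; lra.
have xlt : x < atan y.
  by rewrite -[ltLHS]tanK ?lt_atan // in_itv /=; apply/andP; split; lra.
have e0 : 0 < L%:R * (atan y - x) by rewrite mulr_gt0 ?ltr0n // subr_gt0.
have [K [K0 Kpi]] : exists K, 0 < K /\ pi / 2 - L%:R * (atan y - x) < atan K.
  apply: (@filter_ex _ (+oo%R : set_system R)); near=> K; split; near: K.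
    exact: nbhs_pinfty_gt.
  by apply: cvgr_gt (@cvgy_atan R) _ _; rewrite gtrBl.
have [s [s0 u1 hy hK]] := @exists_near_band_edge a y K a0 ya.
exists s; split=> //.
have T0 := tanh_half_gt0 s0.
have u1' : 0 < 1 - coupling a s by rewrite subr_gt0.
have y0 : 0 < y by lra.
have Tu : tanh_half s ^+ 2 <= coupling a s.
  rewrite -subr_ge0; apply/ltW/(le_lt_trans _ hy).
  by rewrite mulr_ge0 ?sqr_ge0 // ltW.
have yw : y < half_angle_tan a s.
  rewrite -(@ltr_pXn2r _ 2) ?nnegrE ?sqrtr_ge0 ?ltW // sqr_half_angle_tan //.
  by rewrite ltr_pdivlMr.
have Kw : K < half_angle_tan a s / tanh_half s.
  have KT : 0 <= K * tanh_half s by rewrite ltW // mulr_gt0.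
  rewrite ltr_pdivlMr // -(@ltr_pXn2r _ 2) ?nnegrE ?sqrtr_ge0 //.
  by rewrite sqr_half_angle_tan // ltr_pdivlMr // exprMn -mulrA.
have := lt_atan Kw; have : L%:R * atan y <= L%:R * atan (half_angle_tan a s).
  by rewrite ler_wpM2l // ltW // lt_atan.
rewrite /phase; lra.
Unshelve. all: by end_near.
Qed.

Lemma phase_surj L a s v : 0 < a -> 0 < s -> coupling a s < 1 ->
    0 < v -> v <= phase L a s ->
  exists t, [/\ 0 < t, tanh_half t ^+ 2 < coupling a t, coupling a t < 1
    & phase L a t = v].
Proof.
move=> a0 s0 u1 v0 vs.
(* Far enough to the right to be past the band: [a / (2 b) <= T 1 <= T b]. *)
pose b := s + 1 + a / (2 * tanh_half 1).
have T1 : 0 < tanh_half 1 :> R by apply: tanh_half_gt0.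
have q0 : 0 < a / (2 * tanh_half 1) by rewrite divr_gt0 // mulr_gt0.
have sb : s < b by rewrite /b; lra.
have b1 : 1 < b by rewrite /b; lra.
have b0 : 0 < b by lra.
have ub : coupling a b < 1 := lt_trans (lt_coupling a0 s0 sb) u1.
have Tb := lt_tanh_half b1.
have pb : phase L a b = 0.
  apply: phase_eq0 => //.
  rewrite /coupling expr2 mulrAC ler_pM2r; last by lra.
  rewrite ler_pdivrMr ?mulr_gt0 //.
  have : a < 2 * b * tanh_half 1.
    have : a / (2 * tanh_half 1) < b by rewrite /b; lra.
    by rewrite ltr_pdivrMr ?mulr_gt0 //; lra.
  have : 2 * b * tanh_half 1 <= tanh_half b * (2 * b).
    by rewrite mulrC ler_pM2r ?mulr_gt0 // ltW.
  by lra.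
have [||t] := @IVT R (phase L a) s b v (ltW sb).
- apply: continuous_in_subspaceT => z; rewrite inE /= in_itv /= => /andP[sz _].
  apply: continuous_phase; first lra.
  move: sz; rewrite le_eqVlt => /predU1P[<-//|sz].
  exact: lt_trans (lt_coupling a0 s0 sz) u1.
- by rewrite pb ge_min (ltW v0) orbT /= le_max vs.
rewrite in_itv /= => /andP[st _] pt.
have t0 : 0 < t by lra.
have ut : coupling a t < 1.
  move: st; rewrite le_eqVlt => /predU1P[<-//|st].
  exact: lt_trans (lt_coupling a0 s0 st) u1.
exists t; split=> //.
rewrite ltNge; apply/negP => /(phase_eq0 L ut); rewrite pt => v0'.
by rewrite v0' ltxx in v0.
Qed.

End Phase.

(** * Threshold angles and the count *)

Section ThresholdAngle.
Variable R : realType.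

(** Half the angle of the [j]-th threshold, reflected: [L - j] instead of [j]
    turns the cosine of the threshold into the square of a sine. *)
Definition edge_angle (L j : nat) : R := (L - j)%:R * pi / (2 * L%:R).

Lemma mulr_edge_angle L j : (0 < L)%N ->
  L%:R * edge_angle L j = (L - j)%:R * (pi / 2).
Proof. by move=> L0; rewrite /edge_angle; field; rewrite pnatr_eq0 -lt0n. Qed.

Lemma edge_angle_itv L j : (0 < j)%N -> (0 < L)%N ->
  0 <= edge_angle L j < pi / 2.
Proof.
move=> j0 L0; have p0 := pi_gt0 R.
have l0 : 0 < L%:R :> R by rewrite ltr0n.
apply/andP; split; first by rewrite divr_ge0 ?mulr_ge0 ?pi_ge0.
rewrite -(ltr_pM2l l0) mulr_edge_angle // ltr_pM2r ?divr_gt0 // ltr_nat.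
by rewrite ltn_subrL j0.
Qed.

Lemma threshold_edge_angle L j : (0 < j <= L)%N ->
  threshold R L j = (4 * sin (edge_angle L j) ^+ 2)%:E.
Proof.
case: j => // j /= jL; congr _%:E.
have l0 : L%:R != 0 :> R by rewrite pnatr_eq0 -lt0n (leq_trans _ jL).
have -> : j.+1%:R * pi / L%:R = pi - edge_angle L j.+1 *+ 2 :> R.
  by rewrite /edge_angle natrB // -mulr_natl; field.
rewrite [pi - _]addrC cosDpi cosN cos_mulr2n cos2sin2 -mulr_natl; ring.
Qed.

End ThresholdAngle.

Theorem theorem5p1 (R : realType) (L : nat) (h sigma : R) (j : nat)
  (hL : (2 <= L)%N) (hh : 0 < h) (hsigma : 0 < sigma) (hj : (j < L)%N)
  (hlow : (threshold R L j.+1 < (sigma * h)%:E)%E)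
  (hup : if j == 0%N then ((sigma * h)%:E < threshold R L j)%E
         else ((sigma * h)%:E <= threshold R L j)%E) :
  (discrete_eigenvalues (fun=> h) (fun n : nat => n%:R * sigma) L
     #= `I_(L - j))%card.
Proof.
have L0 : (0 < L)%N by apply: leq_trans hL.
set a := sigma * h in hlow hup.
have a0 : 0 < a by rewrite mulr_gt0.
have p0 := pi_gt0 R.
pose band (s : R) := tanh_half s ^+ 2 < coupling a s /\ coupling a s < 1.
have eigP (kappa : R) : 0 < kappa ->
    discrete_eigenvalues (fun=> h) (fun n : nat => n%:R * sigma) L
      (kappa *i)%C <->
    band (kappa * sigma) /\
    exists m : nat, phase L a (kappa * sigma) = m.+1%:R * (pi / 2).
  move=> k0; have k0' : kappa != 0 by rewrite gt_eqF.
  have s0 : 0 < kappa * sigma by rewrite mulr_gt0.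
  have := transfer_eq0P L a0 s0.
  have -> : a / (2 * (kappa * sigma)) = h / (2 * kappa).
    by rewrite /a; field; rewrite k0' gt_eqF.
  have [S0 _] := scattering_transfer h sigma L k0'.
  move=> [P1 P2]; split.
    move=> [_ _]; rewrite S0 => /eqP; rewrite fmorph_eq0 mulf_eq0.
    rewrite invr_eq0 expf_eq0 expR_eq0 andbF orbF => /eqP /P1[*].
    by split.
  move=> [[b1 b2] b3]; split=> //; rewrite S0 P2; first by rewrite mul0r.
  by split.
(* For [j = 0] the bound is the trivial one, each angle being below [pi / 2]. *)
have phase_ub (s : R) : 0 < s -> band s ->
    phase L a s < (L - j).+1%:R * (pi / 2).
  move=> s0 [Tu u1]; move: hup; case: (posnP j) => [-> _|j0 aj].
    by rewrite subn0 -natr1; exact: phase_lt.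
  rewrite -natr1 mulrDl mul1r -mulr_edge_angle //.
  apply: phase_lt_edge => //; first exact: edge_angle_itv.
  have jL : (0 < j <= L)%N by rewrite j0 ltnW.
  move: aj; rewrite (threshold_edge_angle R jL) lee_fin.
  by rewrite ler_pdivrMr // mulrC.
have [s1 [s10 us1 phs1]] : exists s : R, [/\ 0 < s, coupling a s < 1
    & (L - j)%:R * (pi / 2) < phase L a s].
  have xj := @edge_angle_itv R L j.+1 isT L0.
  have [|s [s0 u1]] := phase_gt_edge L0 a0 xj.
    move: hlow; rewrite (@threshold_edge_angle R L j.+1) // lte_fin.
    by rewrite ltr_pdivlMr // mulrC.
  rewrite mulr_edge_angle // -[X in _ + X]mul1r -mulrDl natr1 -subSn //.
  by exists s.
(* [f m] is the point where the phase equals [(m + 1) pi / 2]. *)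
have /choice [f fP] (m : nat) : exists t : R, (m < L - j)%N ->
    [/\ 0 < t, band t & phase L a t = m.+1%:R * (pi / 2)].
  have [mL|] := ltnP m (L - j); last by exists 0.
  have [||t [t0 Tt ut pt]] :=
      @phase_surj R L a s1 (m.+1%:R * (pi / 2)) a0 s10 us1.
  - by rewrite mulr_gt0 ?ltr0n // divr_gt0.
  - by apply: le_trans (ltW phs1); rewrite ler_pM2r ?divr_gt0 // ler_nat.
  by exists t.
have sg : sigma != 0 by rewrite gt_eqF.
have half_pi : pi / 2 != 0 :> R by rewrite gt_eqF // divr_gt0.
suff -> : discrete_eigenvalues (fun=> h) (fun n : nat => n%:R * sigma) L =
    (fun m => ((f m / sigma) *i)%C) @` `I_(L - j).
  apply: inj_card_eq => m n; rewrite !inE /= => mL nL [] /(divIf sg) fmn.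
  have [_ _ pm] := fP m mL; have [_ _ pn] := fP n nL.
  move: pm; rewrite fmn pn => /(mulIf half_pi) /eqP.
  by rewrite eqr_nat eqSS => /eqP.
apply/seteqP; split=> [k ek|_ [m /= mL <-]]; last first.
  have [t0 bt pt] := fP m mL.
  apply/eigP; first by rewrite divr_gt0.
  by rewrite divfK //; split=> //; exists m.
have [k1 k2] : complex.Re k = 0 /\ 0 < complex.Im k by case: ek.
case: k k1 k2 ek => x kappa /= -> k0 /(eigP _ k0)[bk [m pm]].
have s0 : 0 < kappa * sigma by rewrite mulr_gt0.
have mL : (m < L - j)%N.
  have := phase_ub _ s0 bk; rewrite pm ltr_pM2r ?divr_gt0 //.
  by rewrite ltr_nat ltnS.
have [t0 [Tt ut] pt] := fP m mL.
exists m => //=; congr (_ *i)%C.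
suff -> : f m = kappa * sigma by rewrite mulfK.
case: bk => Tk uk.
case: (ltgtP (f m) (kappa * sigma)) => // lt.
  by have := lt_phase L a0 t0 lt ut Tk; rewrite pt pm ltxx.
by have := lt_phase L a0 s0 lt uk Tt; rewrite pt pm ltxx.
Qed.
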